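(* For positive integers $n_1,\dots,n_t$, \[\operatorname{BR}^1(B_{n_1},C_{n_2},\dots,C_{n_t})=n_1+\sum_{i=2}^t(n_i-1).\]
   Context: $B_n$ denotes the Boolean lattice of all subsets of $[n]$ ordered by inclusion, and $C_n$ denotes a chain (totally ordered set) of $n$ elements. A copy of a poset $P$ in a poset $Q$ is the image of an injection $f:P\to Q$ with $f(x)\le f(y)$ whenever $x\le y$. $\operatorname{BR}^1(P_1,\dots,P_t)$ is the least $N$ such that every coloring of the elements of $B_N$ with colors $\{1,\dots,t\}$ contains, for some $i$, a copy of $P_i$ all of whose elements have color $i$. *)

(* Defs.v *)
From mathcomp Require Import all_boot all_order.

Set Implicit Arguments.
Unset Strict Implicit.
Unset Printing Implicit Defensive.

(* {set T} ordered by inclusion. *)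
Import Order.DefaultSetSubsetOrder.

(* Bundles the display with the order, so that a single family can contain
   Boolean lattices and chains, whose displays differ. *)
Record finPoset := FinPoset {
  finPoset_disp : Order.disp_t;
  finPoset_sort :> finPOrderType finPoset_disp
}.

Definition BooleanLattice (n : nat) : finPoset := FinPoset {set 'I_n}.

Definition Chain (n : nat) : finPoset := FinPoset 'I_n.

(* Copies are weak: incomparable elements of P may have comparable images. *)
Definition is_copy (P Q : finPoset) (S : {set Q}) : Prop :=
  exists f : P -> Q,
    [/\ injective f, {homo f : x y / (x <= y)%O >-> (x <= y)%O}
     & S = [set f x | x : P]].

Definition BR1_arrows (t : nat) (P : 'I_t -> finPoset) (N : nat) : Prop :=
  forall c : BooleanLattice N -> 'I_t,
    exists (i : 'I_t) (S : {set BooleanLattice N}),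
      is_copy (P i) S /\ forall x, x \in S -> c x = i.

(* [is_BR1 P N] states BR^1(P_0, ..., P_(t-1)) = N, where BR^1 is the least N
   with the arrow property; in particular it asserts that one exists. *)
Definition is_BR1 (t : nat) (P : 'I_t -> finPoset) (N : nat) : Prop :=
  BR1_arrows P N /\ forall M : nat, BR1_arrows P M -> N <= M.

(* Colors 1, ..., t are encoded as 0, ..., t-1 with t = k.+1, so the first
   poset sits at index [ord0]. *)
Definition boolean_then_chains (k : nat) (n : 'I_k.+1 -> nat) (i : 'I_k.+1) :
    finPoset :=
  if i == ord0 then BooleanLattice (n i) else Chain (n i).

(* Main.v *)
(** Upper bound: suppose that for every chain color [i] no chain of [n i] sets
    has color [i].  For a set [X] let [h X] be the sum over the chain colors [i]
    of the largest size of an [i]-colored chain of subsets of [X].  Then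
    [h X <= s], where [s] is the sum of the [n i - 1], [h] is monotone, and [h]
    increases strictly at every set which does not have the first color.  Split
    the ground set into [n ord0] points and [s] ordered points, and send [A] to
    [A] together with the first [j] of the ordered points, where [j] is least
    such that [h] of this union is at most [j].  This map is injective and
    monotone, and its values have the first color.

    Lower bound: color sets by cardinality, using at most [n ord0] levels for the
    first color and [n i - 1] levels for the other colors. *)

Require Import Defs.
From mathcomp Require Import all_boot all_order.

Set Implicit Arguments.
Unset Strict Implicit.
Unset Printing Implicit Defensive.

Lemma le_BooleanLattice N (A B : {set 'I_N}) :
  ((A : BooleanLattice N) <= B)%O = (A \subset B).
Proof. by []. Qed.

Lemma le_Chain m (x y : 'I_m) : ((x : Chain m) <= y)%O = (x <= y).
Proof. by []. Qed.

Section ChainHeight.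

Variables (T : finType) (I : eqType) (c : {set T} -> I).

Definition has_chain (i : I) (X : {set T}) (m : nat) : bool :=
  [exists s : m.-tuple {set T},
     sorted (fun A B : {set T} => A \proper B) s &&
     all (fun A : {set T} => (A \subset X) && (c A == i)) s].

(* Truncated below [b]: this is the true maximum only when no chain of color [i]
   has size [b]. *)
Definition chain_height (i : I) (b : nat) (X : {set T}) : nat :=
  \max_(m < b | has_chain i X m) m.

Lemma has_chain0 i X : has_chain i X 0.
Proof. by apply/existsP; exists [tuple]. Qed.

Lemma has_chain_sub i (X Y : {set T}) m :
  X \subset Y -> has_chain i X m -> has_chain i Y m.
Proof.
move=> sXY /existsP[s /andP[sorted_s /allP s_in]].
apply/existsP; exists s; rewrite sorted_s; apply/allP => A /s_in /andP[sAX ->].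
by rewrite (subset_trans sAX sXY).
Qed.

(** Every member of a chain inside [X] is a proper subset of [Y], so [Y] can be appended on top. *)
Lemma has_chainS i (X Y : {set T}) m :
  X \proper Y -> c Y = i -> has_chain i X m -> has_chain i Y m.+1.
Proof.
move=> ltXY cY /existsP[s /andP[sorted_s /allP s_in]].
apply/existsP; exists [tuple of rcons s Y] => /=.
apply/andP; split; last first.
  rewrite all_rcons subxx cY eqxx; apply/allP => A /s_in /andP[sAX ->].
  by rewrite (subset_trans sAX (proper_sub ltXY)).
have : all (fun A : {set T} => A \proper Y) s.
  by apply/allP => A /s_in /andP[sAX _]; apply: sub_proper_trans ltXY.
case: (tval s) sorted_s => [//|A r] /= path_r /andP[ltAY lt_rY].
rewrite rcons_path path_r.
have := mem_last A r; rewrite inE => /predU1P[-> //|].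
exact: (allP lt_rY).
Qed.

Lemma has_chain_homo i X m : has_chain i X m ->
  exists2 f : 'I_m -> {set T},
    {homo f : x y / x < y >-> x \proper y} & forall x, c (f x) = i.
Proof.
case/existsP=> s /andP[sorted_s /allP s_in]; exists (tnth s); last first.
  by move=> x; have /s_in /andP[_ /eqP] := mem_tnth x s.
move=> x y ltxy; rewrite !(tnth_nth set0).
have proper_tr : transitive (fun A B : {set T} => A \proper B).
  by move=> A B C; apply: proper_trans.
by apply: (sorted_ltn_nth proper_tr set0 sorted_s); rewrite ?inE ?size_tuple.
Qed.

Lemma chain_height_le i b X : chain_height i b X <= b - 1.
Proof.
apply/bigmax_leqP => m _; rewrite -ltnS.
by case: b m => [[]|b m] //; rewrite subn1.
Qed.

Lemma chain_height_sub i b (X Y : {set T}) :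
  X \subset Y -> chain_height i b X <= chain_height i b Y.
Proof.
move=> sXY; apply/bigmax_leqP => m /(has_chain_sub sXY) Ym.
exact: (leq_bigmax_cond (F := fun m : 'I_b => m : nat)).
Qed.

(** The first hypothesis makes the truncation harmless: it excludes [m = b], and any smaller [m] is
    a term of the maximum. *)
Lemma chain_height_ge i b X m :
  (forall Z, ~~ has_chain i Z b) -> m <= b -> has_chain i X m ->
  m <= chain_height i b X.
Proof.
move=> nob; rewrite leq_eqVlt => /predU1P[-> /(negP (nob X)) // | ltmb Xm].
exact: (leq_bigmax_cond (F := fun m : 'I_b => m : nat) (Ordinal ltmb)).
Qed.

Lemma chain_height_gt0 i b X : 0 < b ->
  (forall Z, ~~ has_chain i Z b) -> c X = i -> 0 < chain_height i b X.
Proof.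
move=> b_gt0 nob cX; apply: chain_height_ge => //.
by apply/existsP; exists [tuple X]; rewrite /= subxx cX eqxx.
Qed.

Lemma chain_height_proper i b (X Y : {set T}) : 0 < b ->
  (forall Z, ~~ has_chain i Z b) -> X \proper Y -> c Y = i ->
  chain_height i b X < chain_height i b Y.
Proof.
move=> b_gt0 nob ltXY cY.
(* The maximum is attained, because the empty chain makes the index 0 admissible. *)
have [m Xm ->] : {m : 'I_b | has_chain i X m & chain_height i b X = m}.
  apply: eq_bigmax_cond; apply/card_gt0P; exists (Ordinal b_gt0).
  exact: has_chain0.
by apply: chain_height_ge => //; apply: has_chainS Xm.
Qed.

End ChainHeight.

Section ShiftedBoolean.

Variables (n s : nat) (h : {set 'I_(n + s)} -> nat).

Definition shifted (A : {set 'I_n}) (j : nat) : {set 'I_(n + s)} :=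
  lshift s @: A :|: @rshift n s @: [set x : 'I_s | x < j].

Lemma lshift_shifted A j x : (lshift s x \in shifted A j) = (x \in A).
Proof.
rewrite !inE mem_imset; last exact: lshift_inj.
case: imsetP => [[y _ /eqP]|_]; last by rewrite orbF.
by rewrite eq_lrshift.
Qed.

Lemma rshift_shifted A j x : (@rshift n s x \in shifted A j) = (x < j).
Proof.
rewrite !inE orbC mem_imset ?inE; last exact: rshift_inj.
case: imsetP => [[y _ /eqP]|_]; last by rewrite orbF.
by rewrite eq_rlshift.
Qed.

Lemma shifted_sub (A B : {set 'I_n}) i j :
  A \subset B -> i <= j -> shifted A i \subset shifted B j.
Proof.
move=> sAB leij; apply: setUSS; first exact: imsetS.
by apply: imsetS; apply/subsetP => x; rewrite !inE => /leq_trans; apply.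
Qed.

Lemma shiftedS_proper A j : j < s -> shifted A j \proper shifted A j.+1.
Proof.
move=> ltjs; rewrite properE shifted_sub //=; apply/subsetPn.
by exists (rshift n (Ordinal ltjs)); rewrite rshift_shifted ?ltnn /=.
Qed.

Hypothesis h_le : forall X, h X <= s.

Lemma shifted_level_ex A : exists j, h (shifted A j) <= j.
Proof. by exists s. Qed.

Definition level A := ex_minn (shifted_level_ex A).

(** The trace on the left block recovers [A], whatever the level. *)
Lemma shifted_level_inj : injective (fun A => shifted A (level A)).
Proof.
move=> A B eqAB; apply/setP => x.
by rewrite -(lshift_shifted A (level A)) eqAB lshift_shifted.
Qed.

Hypothesis h_sub : forall X Y : {set 'I_(n + s)}, X \subset Y -> h X <= h Y.

(** By monotonicity of [h], an index admissible for [B] is admissible for [A], so the least one can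
    only grow. *)
Lemma shifted_level_sub (A B : {set 'I_n}) :
  A \subset B -> shifted A (level A) \subset shifted B (level B).
Proof.
move=> sAB; apply: shifted_sub => //; rewrite /level.
case: ex_minnP => i _ min_i; case: ex_minnP => j le_hj _.
by apply/min_i/(leq_trans _ le_hj)/h_sub/shifted_sub.
Qed.

Variable F : pred {set 'I_(n + s)}.
Hypothesis h_gt0 : forall X, ~~ F X -> 0 < h X.
Hypothesis h_proper :
  forall X Y : {set 'I_(n + s)}, X \proper Y -> ~~ F Y -> h X < h Y.

(** If [F] failed at level [j.+1], removing the last added point would lower [h] to at most [j],
    against minimality; at level 0, [h] would be both zero and positive. *)
Lemma shifted_levelP A : F (shifted A (level A)).
Proof.
apply/negPn/negP; rewrite /level; case: ex_minnP => -[|j] le_hj min_j.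
  by move/h_gt0; rewrite ltnNge le_hj.
(* The index [s] is admissible by [h_le], so the least one is at most [s]. *)
have ltjs : j < s by apply: min_j.
move/(h_proper (shiftedS_proper A ltjs)).
by move/leq_trans/(_ le_hj); rewrite ltnS => /min_j; rewrite ltnn.
Qed.

End ShiftedBoolean.

(** The [M.+1] cardinalities get distinct slots in a disjoint union of blocks of sizes [w i], and a
    set is colored by its block. Members of a chain differ in cardinality, so a chain of color [i]
    uses distinct slots of block [i]. *)
Lemma level_coloring (k : nat) (w : 'I_k.+1 -> nat) (M : nat) :
  M < \sum_i w i ->
  exists c : {set 'I_M} -> 'I_k.+1,
    forall (i : 'I_k.+1) (m : nat) (f : 'I_m -> {set 'I_M}),
      {homo f : x y / x < y >-> x \proper y} -> (forall x, c (f x) = i) ->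
      m <= w i.
Proof.
move=> ltM; pose U := {i : 'I_k.+1 & 'I_(w i)}.
have leMU : M.+1 <= #|{: U}|.
  rewrite card_tagged sumnE big_map big_enum.
  by under eq_bigr do rewrite card_ord.
pose g (j : 'I_M.+1) : U := enum_val (widen_ord leMU j).
have g_inj : injective g by move=> x y /enum_val_inj/(congr1 val)/= /val_inj.
pose lev (A : {set 'I_M}) : 'I_M.+1 := inord #|A|.
have levE A : lev A = #|A| :> nat.
  by rewrite inordK // ltnS -[leqRHS]card_ord max_card.
exists (fun A => tag (g (lev A))) => i m f f_homo cf.
have gf_inj : injective (fun x => g (lev (f x))).
  move=> x y /g_inj/(congr1 val); rewrite /= !levE => eq_card; apply/val_inj.
  by case: (ltngtP x y) => // /f_homo/proper_card; rewrite eq_card ltnn.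
rewrite -[m]card_ord -(card_codom gf_inj) -[w i]card_ord.
apply: leq_trans (leq_image_card (Tagged (fun i => 'I_(w i)) (i := i)) _).
apply/subset_leq_card/subsetP => _ /codomP[x ->].
have := cf x; case: (g _) => j y /= <-.
exact: image_f.
Qed.

Lemma BR1_arrows_upper (k : nat) (n : 'I_k.+1 -> nat) :
  (forall i, 0 < n i) ->
  BR1_arrows (boolean_then_chains n)
             (n ord0 + \sum_(i < k.+1 | i != ord0) (n i - 1)).
Proof.
move=> n_gt0 c; set s := \sum_(i | _) _ in c *.
case: (pickP (fun i : 'I_k.+1 =>
   (i != ord0) && [exists X, has_chain c i X (n i)])) => [i | no_chain].
  case/andP=> i_neq0 /existsP[X /has_chain_homo[f f_homo cf]].
  exists i, [set f x | x : 'I_(n i)]; split; last by move=> _ /imsetP[x _ ->].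
  rewrite /boolean_then_chains (negbTE i_neq0); exists f; split => //.
    move=> x y eqf; apply/val_inj.
    by case: (ltngtP x y) => // /f_homo; rewrite eqf properxx.
  move=> x y; rewrite le_Chain le_BooleanLattice leq_eqVlt.
  move=> /predU1P[/val_inj->//|].
  by move/f_homo/proper_sub.
have {}no_chain i : i != ord0 -> forall X, ~~ has_chain c i X (n i).
  move=> i_neq0 X; apply/negP => Xi.
  by have /negP[] := no_chain i; rewrite i_neq0; apply/existsP; exists X.
pose h X := \sum_(i < k.+1 | i != ord0) chain_height c i (n i) X.
have h_le X : h X <= s by apply: leq_sum => i _; apply: chain_height_le.
have h_sub (X Y : {set _}) : X \subset Y -> h X <= h Y.
  by move=> sXY; apply: leq_sum => i _; apply: chain_height_sub.
have h_gt0 X : c X != ord0 -> 0 < h X.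
  move=> cX; rewrite /h (bigD1 (c X)) //= ltn_addr //.
  by apply: chain_height_gt0 => //; apply: no_chain.
have h_proper (X Y : {set _}) : X \proper Y -> c Y != ord0 -> h X < h Y.
  (* The summand of color [c Y] grows strictly, the others weakly. *)
  move=> ltXY cY; rewrite /h (bigD1 (c Y)) //= [ltnRHS](bigD1 (c Y)) //=.
  rewrite -addSn leq_add //.
    by apply: chain_height_proper (no_chain _ cY) _ _.
  by apply: leq_sum => i _; apply/chain_height_sub/proper_sub.
pose f A := shifted s A (level h_le A).
exists ord0, [set f x | x : {set 'I_(n ord0)}]; split; last first.
  move=> _ /imsetP[A _ ->].
  exact/eqP/(shifted_levelP h_le (F := fun X => c X == ord0)).
exists f; split => //; first exact: shifted_level_inj.
by move=> A B; rewrite !le_BooleanLattice; apply: shifted_level_sub.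
Qed.

Lemma BR1_arrows_lower (k : nat) (n : 'I_k.+1 -> nat) (M : nat) :
  (forall i, 0 < n i) ->
  BR1_arrows (boolean_then_chains n) M ->
  n ord0 + \sum_(i < k.+1 | i != ord0) (n i - 1) <= M.
Proof.
move=> n_gt0 arrM; rewrite leqNgt; apply/negP => ltM.
pose w i := if i == ord0 then n i else n i - 1.
have /level_coloring[c cP] : M < \sum_(i < k.+1) w i.
  rewrite (bigD1 ord0) //= {1}/w eqxx.
  by under eq_bigr => i i_neq0 do rewrite /w (negbTE i_neq0).
have [i [S [[f [f_inj f_homo defS]] cS]]] := arrM c.
have cf x : c (f x) = i by apply: cS; rewrite defS imset_f.
move: f f_inj f_homo cf {S cS defS}.
have := cP i; rewrite /w /boolean_then_chains; case: eqP => _ ciP.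
  move=> f f_inj f_homo cf.
  (* The initial segments form a chain of [(n i).+1] sets, one more than the first color allows. *)
  pose a (j : 'I_(n i).+1) := [set x : 'I_(n i) | x < j].
  suff: (n i).+1 <= n i by rewrite ltnn.
  apply: (ciP _ (fun j => f (a j))) => [x y ltxy|x]; last exact: cf.
  have ltx : x < n i by apply: leq_trans ltxy _; rewrite -ltnS.
  rewrite properEneq -le_BooleanLattice f_homo ?andbT; last first.
    by rewrite le_BooleanLattice; apply/subsetP => z; rewrite !inE => /ltn_trans->.
  (* The point [x] lies in [a y] but not in [a x]. *)
  apply/eqP => /f_inj/setP/(_ (Ordinal ltx)).
  by rewrite !inE /= ltnn ltxy.
move=> f f_inj f_homo cf; suff: n i <= n i - 1 by rewrite leqNgt subn1 ltn_predL n_gt0.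
apply: (ciP _ f) => // x y ltxy; rewrite properEneq -le_BooleanLattice.
rewrite f_homo ?andbT; last by rewrite le_Chain ltnW.
by apply/eqP => /f_inj eqxy; rewrite eqxy ltnn in ltxy.
Qed.

Theorem theorem2p2 (k : nat) (n : 'I_k.+1 -> nat)
    (n_gt0 : forall i : 'I_k.+1, 0 < n i) :
  is_BR1 (boolean_then_chains n)
         (n ord0 + \sum_(i < k.+1 | i != ord0) (n i - 1)).
Proof.
by split=> [|M]; [apply: BR1_arrows_upper | apply: BR1_arrows_lower].
Qed.
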